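(* Let $I\subseteq\mathbb R$ be open and let $\phi:I\to\mathbb R$ be a smooth function satisfying $\phi>0$. Let $F_0:A_0\subseteq TM\to\mathbb R$ be a conic Finsler metric on a manifold $M$, with fundamental tensor $g^0$ and angular metric $h^0$, and let $\beta$ be a one-form on $M$. Consider the conic pseudo-Finsler metric $$F(v)=F_0(v)\,\phi\Big(\frac{\beta(v)}{F_0(v)}\Big)$$ on $A:=\{v\in A_0:\beta(v)/F_0(v)\in I\}$ (assumed to satisfy $\pi(A)=M$), with the convention that, for each $p\in M$, the zero vector $0_p\in A_p=A\cap T_pM$ if and only if $T_pM\setminus\{0_p\}\subset A_p$. Put $\psi:=\phi^2$ and $$\varphi_1(s):=2\psi(s)-s\dot\psi(s)\ \big(=2\phi(\phi-s\dot\phi)\big),\qquad \varphi_2:=2\psi\ddot\psi-\dot\psi^2\ \big(=4\ddot\phi\,\phi^3\big).$$ Then the fundamental tensor $g$ of $F$ is determined by $$2g_v(w,w)=\varphi_1(s)\,h^0_v(w,w)+\frac{\varphi_2(s)}{2\psi(s)}\Big(\frac{\beta(v)}{F_0(v)^2}g^0_v(v,w)-\beta(w)\Big)^2+\frac{1}{2\psi(s)}\Big(\varphi_1(s)\frac{g^0_v(v,w)}{F_0(v)}+\dot\psi(s)\beta(w)\Big)^2,$$ where $s=\beta(v)/F_0(v)$, for all $v\in A\setminus0$ and $w\in T_{\pi(v)}M$. Moreover, $F$ is a conic Finsler metric on $A$ if $$\varphi_1>0\ (\text{i.e. }\phi(s)-s\dot\phi(s)>0)\qquad\text{and}\qquad\varphi_2\ge0\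 (\text{i.e. }\ddot\phi\ge0).$$
   Context: Let $\pi:TM\to M$ be the natural projection. A conic pseudo-Finsler metric on $M$ with domain $A$ is a continuous function $F:A\to[0,\infty)$, where $A\subset TM$ is open with $\pi(A)=M$ and conic ($v\in A$, $\lambda>0$ imply $\lambda v\in A$), which is smooth on $A$ except at most at the zero vectors, with $F(v)=0$ iff $v$ is a zero vector (so $F(0_p)=0$ when $0_p\in A$) and $F(\lambda v)=\lambda F(v)$ for $\lambda>0$, $v\in A$. Its fundamental tensor is $g_v(u,w)=\frac12\frac{\partial^2}{\partial t\partial s}F(v+tu+sw)^2|_{t=s=0}$ for $v\in A\setminus0$ (nonzero vectors of $A$), $u,w\in T_{\pi(v)}M$. It is a conic Finsler metric if $g_v$ is positive definite for all $v\in A\setminus0$. The angular metric of $F_0$ is $h^0_v(w,w)=g^0_v(w,w)-\frac1{F_0(v)^2}g^0_v(v,w)^2$. Dots denote derivatives of functions of one real variable. *)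

(* Defs.v *)
From HB Require Import structures.
From mathcomp Require Import all_boot all_order all_algebra.
From mathcomp Require Import all_classical all_reals all_analysis.

Set Implicit Arguments.
Unset Strict Implicit.
Unset Printing Implicit Defensive.

Import Order.TTheory GRing.Theory Num.Theory.
Import numFieldNormedType.Exports.

Local Open Scope classical_set_scope.
Local Open Scope ring_scope.

(* Meant for open [U]; only the values of [f] on [U] matter.  In finite
   dimension [Ck k U f] says that [f] is of class C^k on [U]. *)
Fixpoint Ck (R : realType) (V W : normedModType R) (k : nat)
    (U : set V) (f : V -> W) : Prop :=
  match k with
  | 0 => forall x, U x -> {for x, continuous f}
  | k'.+1 => (forall x, U x -> differentiable f x) /\
             (forall v : V, Ck k' U (fun x => 'd f x v))
  end.

Definition smooth (R : realType) (V W : normedModType R)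
    (U : set V) (f : V -> W) : Prop := forall k, Ck k U f.

Definition smooth1 (R : realType) (I : set R) (f : R -> R) : Prop :=
  forall k s, I s -> derivable (derive1n k f) s 1.

(* A homeomorphism between an open subset of [M] and an open subset of R^n;
   the two functions are total, but their values off the domain and the
   codomain are irrelevant. *)
Record chart (R : realType) (n : nat) (M : topologicalType) := Chart {
  cdom : set M;
  ccod : set 'rV[R]_n;
  cmap : M -> 'rV[R]_n;
  cinv : 'rV[R]_n -> M;
  cdom_open : open cdom;
  ccod_open : open ccod;
  cmap_cod : forall p, cdom p -> ccod (cmap p);
  cinv_dom : forall x, ccod x -> cdom (cinv x);
  cmapK : forall p, cdom p -> cinv (cmap p) = p;
  cinvK : forall x, ccod x -> cmap (cinv x) = x;
  cmap_continuous : {within cdom, continuous cmap};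
  cinv_continuous : {within ccod, continuous cinv}
}.

(* A smooth manifold of dimension [n], given by an atlas in which, for each
   point, one chart around it has been singled out; the latter only serves to
   represent tangent vectors. *)
Record manifold (R : realType) (n : nat) := Manifold {
  points :> topologicalType;
  points_hausdorff : hausdorff_space points;
  points_second_countable : @second_countable points;
  atlas : set (chart R n points);
  atlas_compat : forall c d, atlas c -> atlas d ->
    smooth [set x | ccod c x /\ cdom d (cinv c x)] (cmap d \o cinv c);
  chart_at : points -> chart R n points;
  chart_at_atlas : forall p, atlas (chart_at p);
  chart_at_dom : forall p, cdom (chart_at p) p
}.

Arguments atlas {R n} m _.

(* The tangent bundle.  A tangent vector at [p] is represented by its
   components [vec] in the chart [chart_at p], so that T_pM is 'rV[R]_n. *)
Record TM (R : realType) (n : nat) (M : manifold R n) := TVec {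
  base : M;
  vec : 'rV[R]_n
}.

(* The tangent vector with components [z.2] in the chart [c] at the point with
   coordinates [z.1]: its components in the chosen chart at that point are
   obtained through the differential of the change of charts. *)
Definition Tinv (R : realType) (n : nat) (M : manifold R n) (c : chart R n M)
    (z : 'rV[R]_n * 'rV[R]_n) : TM M :=
  let p := cinv c z.1 in
  TVec p ('d (cmap (chart_at p) \o cinv c) (z.1) (z.2)).

(* The usual topology of TM, i.e., the final one with respect to the
   parametrizations [Tinv c], with [c] in the atlas. *)
Definition open_TM (R : realType) (n : nat) (M : manifold R n)
    (A : set (TM M)) : Prop :=
  forall c, atlas M c -> open [set z | ccod c z.1 /\ A (Tinv c z)].

Lemma open_TM_T (R : realType) (n : nat) (M : manifold R n) :
  open_TM [set: TM M].
Proof.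
move=> c _; rewrite (_ : mkset _ = fst @^-1` ccod c); last first.
  by apply/seteqP; split => z //= [].
apply: open_comp; last exact: ccod_open.
by move=> z _; exact: cvg_fst.
Qed.

Lemma open_TM_I (R : realType) (n : nat) (M : manifold R n) :
  setI_closed (@open_TM R n M).
Proof.
move=> A B oA oB c ac.
rewrite (_ : mkset _ = [set z | ccod c z.1 /\ A (Tinv c z)] `&`
                       [set z | ccod c z.1 /\ B (Tinv c z)]).
  by apply: openI; [exact: oA|exact: oB].
by apply/seteqP; split => z /= => [[? []]|[[? ?] []]].
Qed.

Lemma open_TM_bigU (R : realType) (n : nat) (M : manifold R n)
    (J : Type) (f : J -> set (TM M)) :
  (forall i, open_TM (f i)) -> open_TM (\bigcup_i f i).
Proof.
move=> of_ c ac.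
rewrite (_ : mkset _ = \bigcup_i [set z | ccod c z.1 /\ f i (Tinv c z)]).
  by apply: bigcup_open => i _; exact: of_.
by apply/seteqP; split => z /= => [[? [i _ ?]]|[i _ [? ?]]]; [exists i|split => //; exists i].
Qed.

HB.instance Definition _ (R : realType) (n : nat) (M : manifold R n) :=
  gen_eqMixin (TM M).
HB.instance Definition _ (R : realType) (n : nat) (M : manifold R n) :=
  gen_choiceMixin (TM M).
HB.instance Definition _ (R : realType) (n : nat) (M : manifold R n) :=
  isOpenTopological.Build (TM M)
    (@open_TM_T R n M) (@open_TM_I R n M) (@open_TM_bigU R n M).

Definition zero_vectors (R : realType) (n : nat) (M : manifold R n) :
  set (TM M) := [set v | vec v = 0].

Arguments zero_vectors {R n} M _.

(* Meant for open [B]; only the values of [f] on [B] matter. *)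
Definition smooth_TM (R : realType) (n : nat) (M : manifold R n)
    (B : set (TM M)) (f : TM M -> R) : Prop :=
  forall c, atlas M c ->
    smooth [set z | ccod c z.1 /\ B (Tinv c z)] (f \o Tinv c : _ -> R^o).

(* Smoothness is that of the components in the charts of the atlas. *)
Definition one_form (R : realType) (n : nat) (M : manifold R n)
    (beta : TM M -> R) : Prop :=
  (forall (p : M) (a : R) (u w : 'rV[R]_n),
     beta (TVec p (a *: u + w)) = a * beta (TVec p u) + beta (TVec p w)) /\
  (forall c, atlas M c -> forall i : 'I_n,
     smooth (ccod c)
       ((fun x => beta (Tinv c (x, delta_mx 0 i))) : 'rV[R]_n -> R^o)).

(* Only the values of [F] on [A] matter. *)
Record conic_pseudo_Finsler (R : realType) (n : nat) (M : manifold R n)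
    (A : set (TM M)) (F : TM M -> R) : Prop := {
  cpF_open : open A;
  cpF_proj : (@base R n M) @` A = setT;
  cpF_conic : forall (p : M) (v : 'rV[R]_n) (l : R),
    A (TVec p v) -> 0 < l -> A (TVec p (l *: v));
  cpF_ge0 : forall v, A v -> 0 <= F v;
  cpF_continuous : {within A, continuous F};
  cpF_smooth : smooth_TM (A `\` zero_vectors M) F;
  cpF_eq0 : forall v, A v -> (F v = 0 <-> zero_vectors M v);
  cpF_homogeneous : forall (p : M) (v : 'rV[R]_n) (l : R),
    A (TVec p v) -> 0 < l -> F (TVec p (l *: v)) = l * F (TVec p v)
}.

(* The tensor g_v(u,w), for a vector [v] at [p]. *)
Definition fundamental_tensor (R : realType) (n : nat) (M : manifold R n)
    (F : TM M -> R) (p : M) (v u w : 'rV[R]_n) : R :=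
  2^-1 * derive1 (fun t : R =>
           derive1 (fun s : R => F (TVec p (v + t *: u + s *: w)) ^+ 2) 0) 0.

Definition angular_metric (R : realType) (n : nat) (M : manifold R n)
    (F : TM M -> R) (p : M) (v w : 'rV[R]_n) : R :=
  fundamental_tensor F p v w w
  - (F (TVec p v) ^+ 2)^-1 * fundamental_tensor F p v v w ^+ 2.

Definition conic_Finsler (R : realType) (n : nat) (M : manifold R n)
    (A : set (TM M)) (F : TM M -> R) : Prop :=
  conic_pseudo_Finsler A F /\
  forall (p : M) (v w : 'rV[R]_n), A (TVec p v) -> v != 0 -> w != 0 ->
    0 < fundamental_tensor F p v w w.

Section PhiMetric.
Variables (R : realType) (n : nat) (M : manifold R n).
Variables (A0 : set (TM M)) (F0 beta : TM M -> R) (I : set R) (phi : R -> R).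

(* Nonzero vectors of the domain. *)
Definition phi_dom0 : set (TM M) :=
  [set v | vec v != 0 /\ A0 v /\ I (beta v / F0 v)].

Definition phi_dom : set (TM M) :=
  [set v | phi_dom0 v \/
     vec v = 0 /\ forall w, w != 0 -> phi_dom0 (TVec (base v) w)].

(* The quotient [beta v / F0 v] makes no sense at a zero vector, where the
   value of the metric is 0. *)
Definition phi_metric (v : TM M) : R :=
  if vec v == 0 then 0 else F0 v * phi (beta v / F0 v).

End PhiMetric.

Section PhiCoefficients.
Variables (R : realType) (phi : R -> R).

Definition psi (s : R) : R := phi s ^+ 2.

Definition varphi1 (s : R) : R := 2 * psi s - s * derive1 psi s.

Definition varphi2 (s : R) : R :=
  2 * psi s * derive1 (derive1 psi) s - derive1 psi s ^+ 2.

End PhiCoefficients.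

(* Main.v *)
(* Everything about [F^2] is computed along the lines [r |-> v + r w] of a fibre,
   where it reads [f^2 psi(b / f)] with [f r = F0 (v + r w)] and [b] affine.
   Homogeneity gives [g0_v(v,w) = f(0) f'(0)] and [h0_v(w,w) = f(0) f''(0)], so
   that the formula for [g] is an identity between two expressions in the
   2-jets at 0.
   With [a = g0_v(v,w) / F0(v)^2] one has [h0_v(w,w) = g0_v(w - a v, w - a v)],
   which is positive unless [w = a v]; in that case the last square of the
   formula is [(2 a F0(v) psi(s))^2], hence positivity.
   At a zero vector of [A], openness of [A] and continuity of [F] follow from
   the compactness of the unit sphere and from conicity: locally in the base
   point, [F(u) <= C |u|]. *)

Require Import Defs.
From HB Require Import structures.
From mathcomp Require Import all_boot all_order all_algebra.
From mathcomp Require Import all_classical all_reals all_analysis.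
From mathcomp Require Import ring.

Set Implicit Arguments.
Unset Strict Implicit.
Unset Printing Implicit Defensive.

Import Order.TTheory GRing.Theory Num.Theory.
Import numFieldNormedType.Exports.

Local Open Scope classical_set_scope.
Local Open Scope ring_scope.

(** * Calculus of C^k maps *)

Section SmoothCalculus.
Context {R : realType}.
Implicit Types V W : normedModType R.

(** Both functions have the same value and the same first-order expansion at [x]; [diff_unique] then
    identifies the differential of [g]. *)
Lemma near_eq_is_diff V W (f g df : V -> W) (x : V) :
  (\near x, f x = g x) -> is_diff x f df -> is_diff x g df.
Proof.
move=> fg [dfx <-].
have g0 : continuous ('d f x) /\ g \o shift x = cst (g x) + 'd f x +o_ 0 id.
  split; first exact: diff_continuous.
  rewrite -(nbhs_singleton fg); apply/eqaddoP => e e0; rewrite near_simpl.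
  have /eqaddoP/(_ e e0) := diff_locally dfx; rewrite near_simpl => fo.
  have := fg; rewrite (near_shift 0 x) /= => fg0.
  by apply: filterS2 fg0 fo => h /=; rewrite !fctE /= subr0 => <-.
have dg : 'd g x = 'd f x :> (V -> W) by case: g0; exact: diff_unique.
by split => //; apply/diff_locallyP; rewrite dg.
Qed.

Lemma eq_in_is_diff V W (U : set V) (f g df : V -> W) x :
  open U -> {in U, f =1 g} -> U x -> is_diff x f df -> is_diff x g df.
Proof.
move=> oU fg Ux; apply: near_eq_is_diff.
by apply: filterS (open_nbhs_nbhs (conj oU Ux)) => y Uy; apply: fg; rewrite inE.
Qed.

(** Since [U] is open, agreement on [U] is agreement near each of its points, so the differentials
    agree on [U] as well and the induction goes through. *)
Lemma eq_in_Ck V W k (U : set V) (f g : V -> W) :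
  open U -> {in U, f =1 g} -> Ck k U f -> Ck k U g.
Proof.
move=> oU; elim: k f g => [|k IH] f g fg /=.
  move=> cf x Ux; have fgx : \near x, f x = g x.
    by apply: filterS (open_nbhs_nbhs (conj oU Ux)) => y Uy; apply: fg; rewrite inE.
  rewrite /prop_for /continuous_at -(nbhs_singleton fgx).
  by apply: cvg_trans (cf _ Ux); apply: near_eq_cvg; apply: filterS fgx.
move=> [df cf]; have dg x : U x -> is_diff x g ('d f x).
  by move=> Ux; apply: (eq_in_is_diff oU fg Ux); apply/differentiableP/df.
split=> [x /dg[]//|v]; apply: IH (cf v) => x /[!inE] Ux.
by have [_ ->] := dg _ Ux.
Qed.

Lemma sub_Ck V W k (U U' : set V) (f : V -> W) : U' `<=` U -> Ck k U f -> Ck k U' f.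
Proof.
move=> UU'; elim: k f => [|k IH] f /=; first by move=> cf x /UU'; exact: cf.
by move=> [df cf]; split=> [x /UU'/df//|v]; exact: IH.
Qed.

Lemma CkS V W k (U : set V) (f : V -> W) : Ck k.+1 U f -> Ck k U f.
Proof.
elim: k f => [|k IH] f /= [df cf].
  by move=> x Ux; apply: differentiable_continuous; exact: df.
by split=> // v; exact: IH.
Qed.

Lemma Ck_cst V W k (U : set V) (a : W) : Ck k U (cst a : V -> W).
Proof.
elim: k a => [|k IH] a /=; first by move=> x _; exact: cst_continuous.
split=> [x _|v]; first exact: differentiable_cst.
rewrite (_ : (fun x => _) = cst 0)//; apply/funext => x.
by rewrite diff_cst.
Qed.

(** Replaces the differential by an explicit [Df], known only on [U]; the inductive step for sums,
    products, inverses and compositions rests on it. *)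
Lemma is_diff_Ck V W k (U : set V) (f : V -> W) (Df : V -> V -> W) :
  open U -> (forall x, U x -> is_diff x f (Df x)) ->
  (forall v, Ck k U (Df ^~ v)) -> Ck k.+1 U f.
Proof.
move=> oU df cf; split=> [x /df[]//|v]; apply: eq_in_Ck (cf v) => // x /[!inE] Ux.
by have [_ ->] := df _ Ux.
Qed.

Lemma Ck_is_diff V W k (U : set V) (f : V -> W) x :
  Ck k.+1 U f -> U x -> is_diff x f ('d f x).
Proof. by move=> [df _] /df /differentiableP. Qed.

Lemma CkD V W k (U : set V) (f g : V -> W) :
  open U -> Ck k U f -> Ck k U g -> Ck k U (f + g).
Proof.
move=> oU; elim: k f g => [|k IH] f g cf cg.
  by move=> x Ux; apply: continuousD; [exact: cf|exact: cg].
apply: (@is_diff_Ck V W k U (f + g) (fun x v => 'd f x v + 'd g x v) oU).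
  move=> x Ux; have ? := Ck_is_diff cf Ux; have ? := Ck_is_diff cg Ux.
  exact: is_diffD.
by move=> v; apply: IH; [exact: cf.2|exact: cg.2].
Qed.

Lemma Ck_sum V W k (U : set V) n (f : 'I_n -> V -> W) :
  open U -> (forall i, Ck k U (f i)) -> Ck k U (\sum_i f i).
Proof.
move=> oU cf; elim/big_ind : _ => //; first exact: Ck_cst.
by move=> *; exact: CkD.
Qed.

Lemma CkM V k (U : set V) (f g : V -> R^o) :
  open U -> Ck k U f -> Ck k U g -> Ck k U (f * g : V -> R^o).
Proof.
move=> oU; elim: k f g => [|k IH] f g cf cg.
  by move=> x Ux; apply: continuousM; [exact: cf|exact: cg].
apply: (@is_diff_Ck V R^o k U (f * g) (fun x v => f x * 'd g x v + g x * 'd f x v)) => //.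
  move=> x Ux; have ? := Ck_is_diff cf Ux; have ? := Ck_is_diff cg Ux.
  exact: (@is_diffM R V f g ('d f x) ('d g x) x).
move=> v.
apply: (@CkD _ _ _ _ (f * (fun x => 'd g x v)) (g * (fun x => 'd f x v))) => //;
  apply: IH => //.
- exact: CkS.
- exact: cg.2.
- exact: CkS.
- exact: cf.2.
Qed.

Lemma linear_is_diff V W (f : V -> W) x :
  linear f -> continuous f -> is_diff x f f.
Proof.
move=> lf cf; pose fL := GRing.isLinear.Build _ _ _ _ _ lf.
pose l : {linear V -> W} := HB.pack f fL; rewrite -[f]/(l : V -> W).
by split; [exact: linear_differentiable|rewrite diff_lin].
Qed.

Lemma Ck_linear V W k (U : set V) (f : V -> W) :
  linear f -> continuous f -> Ck k U f.
Proof.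
move=> lf cf; case: k => [|k] /=; first by move=> x _; exact: cf.
have df x := linear_is_diff x lf cf.
split=> [x _|v]; first by case: (df x).
rewrite (_ : (fun x => _) = cst (f v)); first exact: Ck_cst.
by apply/funext => x; case: (df x) => _ ->.
Qed.

(** The differential [- f^-2 df] contains the inverse itself, but only at order [k], where the
    induction hypothesis provides it. *)
Lemma Ck_inv V k (U : set V) (f : V -> R^o) :
  open U -> (forall x, U x -> f x != 0) -> Ck k U f ->
  Ck k U ((fun x => (f x)^-1) : V -> R^o).
Proof.
move=> oU f0; elim: k => [|k IH] cf.
  by move=> x Ux; apply: continuousV; [exact: f0|exact: cf].
have cV := IH (CkS cf).
apply: (@is_diff_Ck _ _ _ _ _ (fun x v => - (f x) ^- 2 * 'd f x v)) => //.
  move=> x Ux; have [? _] := Ck_is_diff cf Ux; split.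
    by apply: differentiableV => //; exact: f0.
  exact: (@diffV R V f x _ (f0 _ Ux)).
move=> v.
have := CkM oU (CkM oU (Ck_cst k U (-1 : R^o)) (CkM oU cV cV)) (cf.2 v).
by apply: eq_in_Ck => // x _; rewrite !fctE /= mulN1r -invfM expr2.
Qed.

Lemma smooth1_derive1 (I : set R) (h : R -> R) : smooth1 I h -> smooth1 I (derive1 h).
Proof. by move=> sh k; rewrite -[derive1n k _]derive1Sn; exact: sh. Qed.

(** Induction on [k] with [h] generalized: the chain rule produces [derive1 h \o f], and [derive1 h]
    is again smooth on [I]. *)
Lemma Ck_comp1 V k (U : set V) (I : set R) (h : R -> R) (f : V -> R^o) :
  open U -> smooth1 I h -> (forall x, U x -> I (f x)) -> Ck k U f ->
  Ck k U (h \o f : V -> R^o).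
Proof.
move=> oU; elim: k h f => [|k IH] h f sh fI cf.
  move=> x Ux; apply: continuous_comp; first exact: cf.
  by apply/differentiable_continuous/derivable1_diffP; apply: (sh 0%N); exact: fI.
apply: (@is_diff_Ck _ _ _ _ _ (fun x v => derive1 h (f x) * 'd f x v)) => //.
  move=> x Ux; have df := Ck_is_diff cf Ux.
  have dh : derivable h (f x) 1 by apply: (sh 0%N); exact: fI.

  have dh' : is_diff (f x) (h : R^o -> R^o) ( *:%R^~ (derive1 h (f x))).
    by split; [exact/derivable1_diffP|exact: deriv1E].
  have := is_diff_comp df dh'.
  by move=> /is_diff_eq; apply; apply/funext => v /=; rewrite [LHS]mulrC.
move=> v; apply: (@CkM _ _ _ (derive1 h \o f) (fun x => 'd f x v)) => //.
- exact: (IH (derive1 h) f (smooth1_derive1 sh) fI (CkS cf)).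
- exact: cf.2.
Qed.

(** The differential of [f \o l] along [v] is that of [f] along [l v], again composed with [l], so
    the induction hypothesis applies to it directly. *)
Lemma Ck_comp_linear V V' W k (U : set V) (f : V -> W) (l : V' -> V) :
  open U -> linear l -> continuous l -> Ck k U f -> Ck k (l @^-1` U) (f \o l).
Proof.
move=> oU ll cl; have oU' : open (l @^-1` U) by apply: open_comp => // x _; exact: cl.
elim: k f => [|k IH] f cf.
  by move=> x Ux; apply: continuous_comp; [exact: cl|exact: cf].
apply: (@is_diff_Ck _ _ _ _ _ (fun x v => 'd f (l x) (l v))) => //.
  move=> x Ux; have dl := linear_is_diff x ll cl.
  have df : is_diff (l x) f ('d f (l x)) by exact: (Ck_is_diff cf).
  exact: is_diff_comp.
by move=> v; exact: IH (cf.2 (l v)).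
Qed.

End SmoothCalculus.

(** * Derivatives along lines *)

Section DerivativesAlongLines.
Context {R : realType}.
Implicit Types (f g q : R -> R) (x : R).

Lemma is_derive_derive1 f x df : is_derive x (1 : R) f df -> derive1 f x = df.
Proof. by move=> [_ <-]; rewrite derive1E. Qed.

Lemma derive1_is_derive f x : derivable f x (1 : R) -> is_derive x (1 : R) f (derive1 f x).
Proof. by rewrite derive1E => ?; exact: DeriveDef. Qed.

(** The second derivatives below are computed this way, [f1] being a simplified expression of the
    first derivative, valid near [x]. *)
Lemma near_is_derive_derive1 f f1 (f2 : R) x :
  (\forall y \near x, is_derive y (1 : R) f (f1 y)) -> is_derive x (1 : R) f1 f2 ->
  is_derive x (1 : R) (derive1 f) f2.
Proof.
move=> ff1; apply: near_eq_is_derive.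
by apply: filterS ff1 => y /is_derive_derive1 ->.
Qed.

Lemma is_derive_mul f g x df dg :
  is_derive x (1 : R) f df -> is_derive x (1 : R) g dg ->
  is_derive x (1 : R) (fun r => f r * g r) (df * g x + f x * dg).
Proof.
move=> ? ?; have -> : df * g x + f x * dg = f x *: dg + g x *: df.
  by rewrite addrC /GRing.scale /= (mulrC df).
exact: (is_deriveM (f := f) (g := g)).
Qed.

Lemma is_derive_add f g x df dg :
  is_derive x (1 : R) f df -> is_derive x (1 : R) g dg ->
  is_derive x (1 : R) (fun r => f r + g r) (df + dg).
Proof. by move=> ? ?; exact: (is_deriveD (f := f) (g := g)). Qed.

Lemma is_derive_const (a x : R) : is_derive x (1 : R) (fun=> a) 0.
Proof. exact: is_derive_cst. Qed.

Lemma is_derive_comp f g x df dg :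
  is_derive x (1 : R) f df -> is_derive (f x) (1 : R) g dg ->
  is_derive x (1 : R) (g \o f) (dg * df).
Proof. by move=> ? ?; exact: is_derive1_comp. Qed.

Lemma is_derive_inv f x df :
  f x != 0 -> is_derive x (1 : R) f df ->
  is_derive x (1 : R) (fun r => (f r)^-1) (- df / f x ^+ 2).
Proof.
move=> f0 [dfx dfE]; split; first exact: derivableV.
by rewrite (deriveV f0 dfx) dfE /GRing.scale /= mulNr mulrC mulNr.
Qed.

Lemma is_derive_affine (a b x : R) : is_derive x (1 : R) (fun r => a + r * b) b.
Proof.
have := is_derive_add (is_derive_const a x)
  (is_derive_mul (is_derive_id x (1 : R)) (is_derive_const b x)).
by rewrite mulr0 addr0 add0r mul1r.
Qed.

Lemma is_derive_continuous f x df : is_derive x (1 : R) f df -> {for x, continuous f}.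
Proof. by move=> [dfx _]; exact/differentiable_continuous/derivable1_diffP. Qed.

Lemma is_derive_near_neq0 f x (df : R) :
  is_derive x (1 : R) f df -> f x != 0 -> \forall y \near x, f y != 0.
Proof.
move=> /is_derive_continuous cf fx0.
have : nbhs (f x) [set y | y != 0] by apply: open_nbhs_nbhs; split => //; exact: open_neq.
exact: cf.
Qed.

Lemma is_derive_line (V : normedModType R) (h : V -> R^o) (Dh : V -> R^o) (z u : V) x :
  is_diff (z + x *: u) h Dh -> is_derive x (1 : R) (fun r => h (z + r *: u)) (Dh u).
Proof.
move=> [dh <-].
(* A shift of the parameter by [k] moves the point by [k *: u], so the difference quotient of the
   restriction is the one defining the derivative of [h] along [u]. *)
have E : (fun k : R =>
    k^-1 *: (((fun r => h (z + r *: u)) \o shift x) (k *: (1 : R)) - h (z + x *: u)))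
       = (fun k : R => k^-1 *: ((h \o shift (z + x *: u)) (k *: u) - h (z + x *: u))).
  by apply/funext => k /=; rewrite [k *: (1 : R)]mulr1 scalerDl addrCA.
have dE : derive h (z + x *: u) u = 'd h (z + x *: u) u by exact: deriveE.
rewrite -dE; have := diff_derivable (v := u) dh.
by split; rewrite /derivable /derive E.
Qed.

Lemma near_line (V : normedModType R) (U : set V) (z u : V) x :
  open U -> U (z + x *: u) -> \forall r \near x, U (z + r *: u).
Proof.
move=> oU Uz; have cl : {for x, continuous (fun r : R => z + r *: u)}.
  by apply: continuousD; [exact: cst_continuous|exact: scalel_continuous].
by apply: cl; exact: open_nbhs_nbhs.
Qed.

(** The conclusion is the form in which 2-jets are used below: a first derivative near 0, and its
    own derivative at 0. The former is ['d h _ u] along the line, which is of class C^1. *)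
Lemma smooth_line (V : normedModType R) (U : set V) (h : V -> R^o) (z u : V) :
  open U -> Ck 2 U h -> U z ->
  let f := fun r => h (z + r *: u) in
  exists2 f1 : R -> R, (\forall r \near (0 : R), is_derive r (1 : R) f (f1 r))
    & exists df1 : R, is_derive (0 : R) (1 : R) f1 df1.
Proof.
move=> oU ch Uz f; have Uz0 : U (z + 0 *: u) by rewrite scale0r addr0.
exists (fun r => 'd h (z + r *: u) u).
  apply: filterS (near_line oU Uz0) => r Ur.
  by apply: is_derive_line; exact: Ck_is_diff ch Ur.
exists ('d (fun y => 'd h y u) (z + 0 *: u) u).
apply: (is_derive_line (h := fun y => 'd h y u)).
have c1 : Ck 1 U (fun y => 'd h y u) := ch.2 u.
exact: Ck_is_diff c1 Uz0.
Qed.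

(* Euler's argument: the square of a positively 1-homogeneous function along
   the line through [v] directed by [w - a v] is (1 - a r)^2 q(r / (1 - a r)),
   where [q] is its square along the line through [v] directed by [w]. *)
Lemma derive_homogeneous_line q q1 (q2 a : R) :
  (\forall r \near (0 : R), is_derive r (1 : R) q (q1 r)) ->
  is_derive (0 : R) (1 : R) q1 q2 ->
  derive1 (derive1 (fun r => (1 - a * r) ^+ 2 * q (r / (1 - a * r)))) 0 =
  2 * a ^+ 2 * q 0 - 2 * a * q1 0 + q2.
Proof.
move=> qq1 q1q2.
pose l (r : R) : R := 1 + r * - a.
have lE r : 1 - a * r = l r by rewrite /l mulrN (mulrC a).
under eq_fun do rewrite lE.
have dl x : is_derive x (1 : R) l (- a) by exact: is_derive_affine.
have l0 : l 0 = 1 by rewrite /l mul0r addr0.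
pose m (r : R) : R := r / l r.
have m0 : m 0 = 0 by rewrite /m mul0r.
have dm x : l x != 0 -> is_derive x (1 : R) m ((l x)^-1 ^+ 2).
  move=> lx0.
  have := is_derive_mul (is_derive_id x (1 : R)) (is_derive_inv lx0 (dl x)).
  by move=> /is_derive_eq; apply; rewrite /l in lx0 *; field.
have lN0 : \forall r \near (0 : R), l r != 0.
  by apply: is_derive_near_neq0 (dl 0) _; rewrite l0 oner_neq0.
have cm : {for 0, continuous m}.
  by apply: is_derive_continuous (dm _ _); rewrite l0 oner_neq0.
have qm : \forall r \near (0 : R), is_derive (m r) (1 : R) q (q1 (m r)).
  have : nbhs (m 0) [set r | is_derive r (1 : R) q (q1 r)] by rewrite m0.
  exact: cm.
(* The derivative of [m] is [l^-2], which cancels the factor [l^2] in front of [q (m r)]. *)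
pose Q1 (r : R) : R := - 2 * a * (l r * q (m r)) + q1 (m r).
apply: is_derive_derive1; apply: (@near_is_derive_derive1 _ Q1).
  near=> x.
  have lx0 : l x != 0 by near: x.
  have dq : is_derive (m x) (1 : R) q (q1 (m x)) by near: x.
  have dl2 : is_derive x (1 : R) (fun r => l r ^+ 2) (- 2 * a * l x).
    have := is_derive_mul (dl x) (dl x).
    rewrite (_ : (fun r => l r * l r) = (fun r => l r ^+ 2)).
      by move=> /is_derive_eq; apply; ring.
    by apply/funext => r; rewrite expr2.
  have := is_derive_mul dl2 (is_derive_comp (dm _ lx0) dq).
  by move=> /is_derive_eq; apply; rewrite /Q1 /=; field.
have l00 : l 0 != 0 by rewrite l0 oner_neq0.
have dq : is_derive (m 0) (1 : R) q (q1 0) by rewrite m0; exact: nbhs_singleton qq1.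
have dq1 : is_derive (m 0) (1 : R) q1 q2 by rewrite m0.
have := is_derive_add
  (is_derive_mul (is_derive_const (- 2 * a) 0)
     (is_derive_mul (dl 0) (is_derive_comp (dm _ l00) dq)))
  (is_derive_comp (dm _ l00) dq1).
by move=> /is_derive_eq; apply; rewrite /= /cst l0 m0; field.
Unshelve. all: by end_near. Qed.

(** With [b = b0 + r b1] and [k = b / f] one has [k' = (b1 - k f') / f], so the first derivative is
    [2 f f' psi(k) + psi'(k) (f b1 - b f')]; the product and chain rules are then applied once more
    at 0. *)
Lemma derive_phi_line (psi psi1 psi2 f f1 : R -> R) (I : set R)
    (b0 b1 f2 : R) :
  open I ->
  (forall s, I s -> is_derive s (1 : R) psi (psi1 s)) ->
  (forall s, I s -> is_derive s (1 : R) psi1 (psi2 s)) ->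
  (\forall r \near (0 : R), is_derive r (1 : R) f (f1 r)) ->
  is_derive (0 : R) (1 : R) f1 f2 ->
  f 0 != 0 -> I (b0 / f 0) ->
  let s := b0 / f 0 in
  derive1 (derive1 (fun r => f r ^+ 2 * psi ((b0 + r * b1) / f r))) 0 =
  2 * (f1 0 ^+ 2 + f 0 * f2) * psi s
  + 2 * f1 0 * psi1 s * (b1 - s * f1 0)
  + psi2 s * (b1 - s * f1 0) ^+ 2 - psi1 s * b0 * f2.
Proof.
move=> oI dpsi dpsi1 ff1 f1f2 f0 Is s.
pose b (r : R) : R := b0 + r * b1.
have db x : is_derive x (1 : R) b b1 by exact: is_derive_affine.
have b00 : b 0 = b0 by rewrite /b mul0r addr0.
pose k (r : R) : R := b r / f r.
have dk x df : f x != 0 -> is_derive x (1 : R) f df ->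
    is_derive x (1 : R) k ((b1 - k x * df) / f x).
  move=> fx0 dfx; have := is_derive_mul (db x) (is_derive_inv fx0 dfx).
  by move=> /is_derive_eq; apply; rewrite /k; field.
have df0 := nbhs_singleton ff1.
have fN0 : \forall r \near (0 : R), f r != 0.
  exact: is_derive_near_neq0 df0 _.
have k0 : k 0 = s by rewrite /k b00.
have kI : \forall r \near (0 : R), I (k r).
  have ck : {for 0, continuous k} := is_derive_continuous (dk _ _ f0 df0).
  have : nbhs (k 0) I by apply: open_nbhs_nbhs; split => //; rewrite k0.
  exact: ck.
pose Q1 (r : R) : R := 2 * (f r * (f1 r * psi (k r)))
  + psi1 (k r) * (f r * b1 + (- 1) * (b r * f1 r)).
apply: is_derive_derive1; apply: (@near_is_derive_derive1 _ Q1).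
  near=> x.
  have fx0 : f x != 0 by near: x.
  have Ikx : I (k x) by near: x.
  have dfx : is_derive x (1 : R) f (f1 x) by near: x.
  have df2 : is_derive x (1 : R) (fun r => f r ^+ 2) (2 * f x * f1 x).
    have := is_derive_mul dfx dfx; rewrite (_ : (fun r => f r * f r) = (fun r => f r ^+ 2)).
      by move=> /is_derive_eq; apply; ring.
    by apply/funext => r; rewrite expr2.
  have := is_derive_mul df2 (is_derive_comp (dk _ _ fx0 dfx) (dpsi _ Ikx)).
  by move=> /is_derive_eq; apply; rewrite /Q1 /= /k; field.
have Ik0 : I (k 0) by rewrite k0.
have dk0 := dk _ _ f0 df0.
have := is_derive_add
  (is_derive_mul (is_derive_const 2 0)
     (is_derive_mul df0 (is_derive_mul f1f2 (is_derive_comp dk0 (dpsi _ Ik0)))))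
  (is_derive_mul (is_derive_comp dk0 (dpsi1 _ Ik0))
     (is_derive_add (is_derive_mul df0 (is_derive_const b1 0))
        (is_derive_mul (is_derive_const (- 1) 0) (is_derive_mul (db 0) f1f2)))).
by move=> /is_derive_eq; apply; rewrite /= /cst k0 b00 /s; field.
Unshelve. all: by end_near. Qed.

End DerivativesAlongLines.

(** * Charts of the tangent bundle *)

Section Charts.
Context {R : realType} {n : nat} {M : manifold R n}.
Implicit Types c d : chart R n M.

Lemma within_open_continuous (T U : topologicalType) (A : set T) (f : T -> U) :
  open A -> {within A, continuous f} <-> forall x, A x -> {for x, continuous f}.
Proof.
move=> oA; rewrite continuous_open_subspace//.
by split=> cf x xA; apply: cf; rewrite ?inE// -inE.
Qed.

Lemma open_transition_dom c d : open [set x | ccod c x /\ cdom d (cinv c x)].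
Proof.
rewrite openE => x [cx dx].
have /within_open_continuous ci := @cinv_continuous _ _ _ c.
have cix := ci (@ccod_open _ _ _ c) _ cx.
have d' : nbhs (cinv c x) (cdom d) by apply: open_nbhs_nbhs; split => //; exact: cdom_open.
have c' : nbhs x (ccod c) by apply: open_nbhs_nbhs; split => //; exact: ccod_open.
by rewrite /interior; apply: filterI c' (cix _ d').
Qed.

Lemma differentiable_transition c d x :
  atlas M c -> atlas M d -> ccod c x -> cdom d (cinv c x) ->
  differentiable (cmap d \o cinv c) x.
Proof. by move=> ac ad cx dx; have [+ _] := atlas_compat ac ad 1; apply. Qed.

(** Chain rule for the composition of the two transition maps, which is the identity on the open
    overlap. *)
Lemma diff_transitionK c d x :
  atlas M c -> atlas M d -> ccod c x -> cdom d (cinv c x) ->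
  cancel ('d (cmap d \o cinv c) x) ('d (cmap c \o cinv d) (cmap d (cinv c x))).
Proof.
move=> ac ad cx dx u.
have dcd := differentiable_transition ac ad cx dx.
have ddc : differentiable (cmap c \o cinv d) ((cmap d \o cinv c) x).
  apply: differentiable_transition => //=; first exact: cmap_cod.
  by rewrite cmapK//; exact: cinv_dom.
have dcomp := is_diff_comp (differentiableP dcd) (differentiableP ddc).
have cdK : {in [set y | ccod c y /\ cdom d (cinv c y)],
    (cmap c \o cinv d) \o (cmap d \o cinv c) =1 (id : 'rV[R]_n -> 'rV[R]_n)}.
  by move=> y /[!inE] -[cy dy] /=; rewrite cmapK// cinvK.
have did := eq_in_is_diff (@open_transition_dom c d) cdK (conj cx dx) dcomp.
have E := etrans (esym (diff_val (is_diff_def := did)))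
                 (diff_val (is_diff_def := is_diff_id x)).
exact: (congr1 (@^~ u) E).
Qed.

Lemma diff_transition_can c d x :
  atlas M c -> atlas M d -> ccod c x -> cdom d (cinv c x) ->
  cancel ('d (cmap c \o cinv d) (cmap d (cinv c x))) ('d (cmap d \o cinv c) x).
Proof.
move=> ac ad cx dx.
have := @diff_transitionK d c (cmap d (cinv c x)) ad ac.
by rewrite cmapK// cinvK//; apply; [exact: cmap_cod|exact: cinv_dom].
Qed.

(** The differential of a transition map is injective, having a left inverse. *)
Lemma vec_Tinv_eq0 c z : atlas M c -> ccod c z.1 ->
  (vec (Tinv c z) == 0) = (z.2 == 0).
Proof.
move=> ac cz; rewrite /Tinv /=; set p := cinv c z.1.
have K := diff_transitionK ac (chart_at_atlas p) cz (chart_at_dom p).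
by rewrite -[RHS](inj_eq (can_inj K)) linear0.
Qed.

Lemma Tinv_surj c x (w : 'rV[R]_n) : atlas M c -> ccod c x ->
  exists u, Tinv c (x, u) = TVec (cinv c x) w.
Proof.
move=> ac cx; set p := cinv c x.
have K := diff_transition_can ac (chart_at_atlas p) cx (chart_at_dom p).
exists ('d (cmap c \o cinv (chart_at p)) (cmap (chart_at p) p) w).
by congr (TVec _ _); exact: K.
Qed.

Lemma TinvZ c x (l : R) (u : 'rV[R]_n) :
  Tinv c (x, l *: u) = TVec (cinv c x) (l *: vec (Tinv c (x, u))).
Proof. by rewrite /Tinv /= linearZ. Qed.

(** The components of a vector at [p] refer to [chart_at p] itself, and the transition map of this
    chart to itself is the identity on its codomain. The fibre over [p] can thus be read in a chart
    without changing its vectors. *)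
Lemma Tinv_chart_at (p : M) (v : 'rV[R]_n) :
  Tinv (chart_at p) (cmap (chart_at p) p, v) = TVec p v.
Proof.
have pd := chart_at_dom p; rewrite /Tinv /= cmapK//; congr (TVec _ _).
have px : ccod (chart_at p) (cmap (chart_at p) p) by exact: cmap_cod.
have did : is_diff (cmap (chart_at p) p) (cmap (chart_at p) \o cinv (chart_at p)) id.
  apply: (eq_in_is_diff (@ccod_open _ _ _ _) _ px (is_diff_id _)).
  by move=> y /[!inE] cy /=; rewrite cinvK.
by have [_ ->] := did.
Qed.

Lemma open_TMP (A : set (TM M)) :
  open A <-> forall c, atlas M c -> open [set z | ccod c z.1 /\ A (Tinv c z)].
Proof. by []. Qed.

(** The topology of [TM M] is final for the maps [Tinv c], so continuity may be tested after
    composing with them. The preimage of an open set is cut down to the open set [A], the only place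
    where [f] is controlled. *)
Lemma TM_continuousP (T : topologicalType) (A : set (TM M)) (f : TM M -> T) :
  open A ->
  (forall c z, atlas M c -> ccod c z.1 -> A (Tinv c z) ->
     {for z, continuous (f \o Tinv c)}) ->
  {within A, continuous f}.
Proof.
move=> oA cf; apply/within_open_continuous => // v Av O fO.
have [B [oB Bv BO]] : exists B, [/\ open B, B (f v) & B `<=` O].
  by move: fO; rewrite nbhsE => -[B [oB Bv] BO]; exists B.
apply: (@filterS _ _ _ (A `&` f @^-1` B)); first by move=> y [_ /BO].
apply: open_nbhs_nbhs; split=> //; apply/open_TMP => c ac.
rewrite openE => z [cz [Az Bz]].
have nB : nbhs ((f \o Tinv c) z) B by apply: open_nbhs_nbhs.
have nA := open_nbhs_nbhs (conj ((open_TMP A).1 oA c ac) (conj cz Az)).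
have := cf c z ac cz Az _ nB; apply: filterS2 nA => y [? ?] ?.
by split.
Qed.

(** By [vec_Tinv_eq0], zero vectors read [z.2 = 0] in every chart of the atlas, a closed
    condition. *)
Lemma open_nonzero (A : set (TM M)) c : open A -> atlas M c ->
  open [set z | ccod c z.1 /\ (A `\` zero_vectors M) (Tinv c z)].
Proof.
move=> oA ac; rewrite (_ : mkset _ =
  [set z | ccod c z.1 /\ A (Tinv c z)] `&` (snd @^-1` [set u | u != 0])).
  apply: openI; first exact: (open_TMP A).1.
  apply: open_comp; first by move=> z _; exact: cvg_snd.
  have -> : [set u : 'rV[R]_n | u != 0] = ~` [set 0].
    by apply/seteqP; split=> u /= /eqP.
  apply: closed_openC; apply: accessible_closed_set1.
  by apply: hausdorff_accessible; exact: norm_hausdorff.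
apply/seteqP; split=> z /=.
- move=> [cz [Az z0]]; split=> //; rewrite -(vec_Tinv_eq0 ac cz).
  exact/eqP.
- by move=> [[cz Az] z0]; split=> //; split=> //; apply/eqP; rewrite (vec_Tinv_eq0 ac cz).
Qed.

End Charts.

(** * Smoothness and continuity of the metric *)

Section PhiMetricInCharts.
Context {R : realType} {n : nat} {M : manifold R n}.
Implicit Types (c : chart R n M) (beta F : TM M -> R).

Lemma one_form0 beta p : one_form beta -> beta (TVec p 0) = 0.
Proof.
move=> [lb _]; have := lb p 1 0 0; rewrite scaler0 addr0 mul1r => /eqP.
by rewrite -subr_eq0 opprD addNKr oppr_eq0 => /eqP.
Qed.

Lemma one_formZ beta p (l : R) (v : 'rV[R]_n) :
  one_form beta -> beta (TVec p (l *: v)) = l * beta (TVec p v).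
Proof.
by move=> bf; have := bf.1 p l v 0; rewrite addr0 (one_form0 p bf) addr0.
Qed.

Lemma one_form_sum beta p (J : finType) (a : J -> R) (u : J -> 'rV[R]_n) :
  one_form beta ->
  beta (TVec p (\sum_j a j *: u j)) = \sum_j a j * beta (TVec p (u j)).
Proof.
move=> bf; apply: (big_rec2 (fun x y => beta (TVec p x) = y)); first exact: one_form0.
by move=> j y x _ <-; rewrite bf.1.
Qed.

(** Expresses [beta] by its components in [c], whose smoothness is what [one_form] grants. *)
Lemma one_form_Tinv beta c (z : 'rV[R]_n * 'rV[R]_n) : one_form beta ->
  beta (Tinv c z) = \sum_i z.2 0 i * beta (Tinv c (z.1, delta_mx 0 i)).
Proof.
move=> bf; rewrite /Tinv /=; set D := 'd _ _.
have -> : D z.2 = \sum_i z.2 0 i *: D (delta_mx 0 i).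
  rewrite {1}(row_sum_delta z.2) linear_sum; apply: eq_bigr => i _.
  by rewrite linearZ.
exact: one_form_sum.
Qed.



Lemma linear_snd_coord (V : normedModType R) (i : 'I_n) :
  linear ((fun z => z.2 0 i) : V * 'rV[R]_n -> R^o).
Proof. by move=> a u v /=; rewrite !mxE. Qed.

Lemma continuous_fst (V W : topologicalType) : continuous (@fst V W).
Proof. by move=> z; exact: cvg_fst. Qed.

Lemma continuous_snd (V W : topologicalType) : continuous (@snd V W).
Proof. by move=> z; exact: cvg_snd. Qed.

Lemma one_form_Ck beta c k : one_form beta -> atlas M c ->
  Ck k (fst @^-1` ccod c) (beta \o Tinv c : _ -> R^o).
Proof.
move=> bf ac.
have oU : open ((fst : 'rV[R]_n * 'rV[R]_n -> _) @^-1` ccod c).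
  by apply: open_comp; [move=> z _; exact: continuous_fst|exact: ccod_open].
have -> : beta \o Tinv c = \sum_i
    ((fun z : 'rV[R]_n * 'rV[R]_n => z.2 0 i : R^o) *
     ((fun x => beta (Tinv c (x, delta_mx 0 i)) : R^o) \o fst)).
  apply/funext => z; rewrite fct_sumE /= (one_form_Tinv c z bf).
  by apply: eq_bigr.
apply: Ck_sum => // i; apply: CkM => //.
  apply: Ck_linear; first exact: linear_snd_coord.
  move=> z; apply: (@continuous_comp _ _ _ snd (fun u : 'rV[R]_n => u 0 i)).
    exact: continuous_snd.
  exact: coord_continuous.
apply: Ck_comp_linear => //; first exact: ccod_open.
  exact: continuous_fst.
exact: bf.2.
Qed.

Lemma conic_pseudo_Finsler_gt0 (A : set (TM M)) F v :
  conic_pseudo_Finsler A F -> A v -> vec v != 0 -> 0 < F v.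
Proof.
move=> cF Av v0; rewrite lt_neqAle (cpF_ge0 cF)// andbT eq_sym.
by apply/eqP => /(cpF_eq0 cF Av) /eqP; apply/negP.
Qed.

(** * Openness of the domain and regularity of the metric, zero vectors included *)

Section Domain.
Variables (A0 : set (TM M)) (F0 beta : TM M -> R) (I : set R) (phi : R -> R).
Hypotheses (I_open : open I) (phi_smooth : smooth1 I phi).
Hypotheses (F0_Finsler : conic_pseudo_Finsler A0 F0) (beta_form : one_form beta).

Local Notation dom0 := (phi_dom0 A0 F0 beta I).
Local Notation dom := (phi_dom A0 F0 beta I).
Local Notation F := (phi_metric F0 beta phi).
Local Notation chart_dom0 c := [set z | ccod c z.1 /\ dom0 (Tinv c z)].
Local Notation chart_A0 c := [set z | ccod c z.1 /\ (A0 `\` zero_vectors M) (Tinv c z)].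

Lemma phi_dom0_sub c : chart_dom0 c `<=` chart_A0 c.
Proof. by move=> z [cz [z0 [Az _]]]; split=> //; split=> //; exact/eqP. Qed.

Lemma chart_A0_gt0 c z : chart_A0 c z -> 0 < F0 (Tinv c z).
Proof.
by move=> [_ [Az z0]]; apply: conic_pseudo_Finsler_gt0 F0_Finsler Az _; exact/eqP.
Qed.

Lemma ratio_Ck c k : atlas M c ->
  Ck k (chart_A0 c) ((fun z => beta (Tinv c z) / F0 (Tinv c z)) : _ -> R^o).
Proof.
move=> ac; have oA := open_nonzero (cpF_open F0_Finsler) ac.
apply: (@CkM _ _ _ _ (beta \o Tinv c) (fun z => (F0 (Tinv c z))^-1)) => //.
  by apply: sub_Ck (one_form_Ck k beta_form ac) => z [].
apply: Ck_inv => //; first by move=> z /chart_A0_gt0 /lt0r_neq0.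
exact: (cpF_smooth F0_Finsler ac k).
Qed.

(** Within the nonzero part of [A0], this is the preimage of the open set [I] under the continuous
    ratio [beta / F0]. *)
Lemma phi_dom0_open c : atlas M c -> open (chart_dom0 c).
Proof.
move=> ac; have oA := open_nonzero (cpF_open F0_Finsler) ac.
rewrite openE => z dz; have Az := phi_dom0_sub dz.
have cr := ratio_Ck 0 ac _ Az.
have nI : nbhs (beta (Tinv c z) / F0 (Tinv c z)) I.
  by apply: open_nbhs_nbhs; split => //; case: dz => _ [_ []].
apply: filterS2 (open_nbhs_nbhs (conj oA Az)) (cr _ nI) => y [cy [Ay y0]] Iy.
by split => //; split; [exact/eqP|split].
Qed.

Lemma phi_metric_Ck c k : atlas M c ->
  Ck k (chart_dom0 c) (F \o Tinv c : _ -> R^o).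
Proof.
move=> ac; have oW := phi_dom0_open ac.
have cF : Ck k (chart_dom0 c) ((F0 \o Tinv c) *
    (phi \o (fun z => beta (Tinv c z) / F0 (Tinv c z))) : _ -> R^o).
  apply: CkM => //.
    exact: sub_Ck (@phi_dom0_sub c) (cpF_smooth F0_Finsler ac k).
  apply: Ck_comp1 phi_smooth _ _ => //; first by move=> z [_ [_ []]].
  exact: sub_Ck (@phi_dom0_sub c) (ratio_Ck k ac).
apply: eq_in_Ck cF => // z /[!inE] -[cz [z0 _]].
by rewrite /phi_metric /= (negbTE z0).
Qed.

Lemma ratio_conic p (v : 'rV[R]_n) (l : R) : A0 (TVec p v) -> 0 < l ->
  beta (TVec p (l *: v)) / F0 (TVec p (l *: v)) = beta (TVec p v) / F0 (TVec p v).
Proof.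
move=> Av l0; rewrite one_formZ// (cpF_homogeneous F0_Finsler)//.
by rewrite -mulf_div divff ?mul1r// gt_eqF.
Qed.

Lemma phi_dom0_conic p (v : 'rV[R]_n) (l : R) :
  dom0 (TVec p v) -> 0 < l -> dom0 (TVec p (l *: v)).
Proof.
move=> [/= v0 [Av Iv]] l0; split=> /=; first by rewrite scaler_eq0 gt_eqF.
by split; [exact: (cpF_conic F0_Finsler)|rewrite ratio_conic].
Qed.

Lemma phi_metric_homogeneous p (v : 'rV[R]_n) (l : R) :
  dom (TVec p v) -> 0 < l -> F (TVec p (l *: v)) = l * F (TVec p v).
Proof.
move=> dv l0; rewrite /phi_metric /= scaler_eq0 gt_eqF//=.
case: eqP => [_|/eqP v0]; first by rewrite mulr0.
case: dv => [[_ [Av _]]|[/= /eqP]]; last by rewrite (negbTE v0).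
by rewrite ratio_conic// (cpF_homogeneous F0_Finsler)// mulrA.
Qed.

Lemma compact_sphere : compact [set u : 'rV[R]_n | `|u| = 1].
Proof.
apply: bounded_closed_compact.
  by exists 1; split => // x x1 u /= ->; exact: ltW.
rewrite (_ : mkset _ = (Num.norm : 'rV[R]_n -> R) @^-1` [set 1]).
  apply: closed_comp; first by move=> u _; exact: norm_continuous.
  apply: accessible_closed_set1; apply: hausdorff_accessible; exact: Rhausdorff.
by [].
Qed.

(** A tube argument, used at zero vectors. Near [(z.1, u)], with [u] a unit vector, [|F|] is less
    than its value there plus 1; compactness of the sphere makes the neighbourhood of [z.1] and the
    bound uniform, and homogeneity extends both claims to all [u != 0]. *)
Lemma phi_metric_tube c (z : 'rV[R]_n * 'rV[R]_n) : atlas M c -> ccod c z.1 ->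
  (forall u, u != 0 -> dom0 (Tinv c (z.1, u))) ->
  exists C : R, \forall y \near z, ccod c y.1 /\
    forall u, u != 0 -> dom0 (Tinv c (y.1, u)) /\ `|F (Tinv c (y.1, u))| <= C * `|u|.
Proof.
move: z => [x z2] /= ac cx dx.
have oW := phi_dom0_open ac.
(* The parameter pairs base coordinates with a candidate bound. As the latter tends to infinity, a
   single use of compactness yields a common neighbourhood and a common bound. *)
pose P (i : 'rV[R]_n * R) (u : 'rV[R]_n) :=
  chart_dom0 c (i.1, u) /\ `|F (Tinv c (i.1, u))| <= i.2.
have cover u : [set u : 'rV[R]_n | `|u| = 1] u ->
    \forall u' \near u & i \near filter_prod (nbhs x) (pinfty_nbhs R), P i u'.
  move=> /= u1; have u0 : u != 0 by rewrite -normr_eq0 u1 oner_neq0.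
  have dxu : chart_dom0 c (x, u) by split => //; exact: dx.
  have cF := phi_metric_Ck 0 ac _ dxu.
  pose C0 := `|F (Tinv c (x, u))| + 1.
  have nF : nbhs ((F \o Tinv c) (x, u)) [set y : R^o | `|y| < C0].
    apply: open_nbhs_nbhs; split; last by rewrite /= ltrDl.
    rewrite (_ : mkset _ = (Num.norm : R^o -> R) @^-1` [set y | y < C0])//.
    by apply: open_comp; [move=> ? _; exact: norm_continuous|exact: open_lt].
  have [[X Y] /= [nX nY] XY] := filterI (open_nbhs_nbhs (conj oW dxu)) (cF _ nF).
  exists (Y, [set i | X i.1 /\ C0 <= i.2]) => /=.
    split=> //; exists (X, [set r | C0 <= r]) => //=.
    by split=> //; apply: nbhs_pinfty_ge; exact: num_real.
  move=> [u' [x' r]] /= [Yu' [Xx' Cr]].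
  have [dxu' Fxu'] := XY (x', u') (conj Xx' Yu').
  by split=> //=; exact: ltW (lt_le_trans Fxu' Cr).
have [[X Q] /= [nX nQ] XQ] := (compact_near_coveringP _).1 compact_sphere _ _ P _ cover.
have [C QC] := @filter_ex _ (pinfty_nbhs R) _ _ nQ.
have nXc : nbhs x (X `&` ccod c).
  by apply: filterI => //; apply: open_nbhs_nbhs; split=> //; exact: ccod_open.
have nXc' : nbhs (x, z2) (fst @^-1` (X `&` ccod c)) := @continuous_fst _ _ (x, z2) _ nXc.
exists C; apply: filterS nXc' => -[y y2] /= [Xy cy].
split=> // u u0; have nu0 : 0 < `|u| by rewrite normr_gt0.
have un1 : `| `|u|^-1 *: u| = 1.
  by rewrite normrZ normfV normr_id mulVf// gt_eqF.
have [[_ dyu] Fyu] := XQ (y, C) (conj Xy QC) _ un1.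
have uE : u = `|u| *: (`|u|^-1 *: u) by rewrite scalerA divff ?scale1r// gt_eqF.
have dyu' : dom (Tinv c (y, `|u|^-1 *: u)) by left.
rewrite uE TinvZ; split; first exact: phi_dom0_conic.
rewrite phi_metric_homogeneous// normrM -uE normr_id mulrC.
by rewrite ler_pM2r.
Qed.

(** Isolates the vectors at which the openness of [phi_dom0] says nothing, and transports the
    condition on their fibre to the chart [c], as [phi_metric_tube] requires. *)
Lemma dom_zero c z : ccod c z.1 -> atlas M c -> dom (Tinv c z) -> ~ dom0 (Tinv c z) ->
  z = (z.1, 0) /\ forall u, u != 0 -> dom0 (Tinv c (z.1, u)).
Proof.
move=> cz ac [//|[/= z0 dz]] _; split.
  have /eqP := z0; rewrite (vec_Tinv_eq0 ac cz) => /eqP z20.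
  by rewrite -z20 -surjective_pairing.
by move=> u u0; apply: dz; rewrite (@vec_Tinv_eq0 _ _ _ c (z.1, u) ac cz).
Qed.

Lemma phi_dom_open : open dom.
Proof.
apply/open_TMP => c ac; rewrite openE => z [cz dz].
have [d0z|nd0z] := pselect (dom0 (Tinv c z)).
  have := open_nbhs_nbhs (conj (phi_dom0_open ac) (conj cz d0z)).
  by apply: filterS => y [cy dy]; split=> //; left.
have [zE dzu] := dom_zero cz ac dz nd0z.
have [C Cx] := phi_metric_tube ac cz dzu.
apply: filterS Cx => -[y u] /= [cy dy]; split=> //.
have [u0|/dy [dyu _]] := eqVneq u 0; last by left.
(* The zero vector over a nearby point belongs to the domain because its whole punctured fibre lies
   in [phi_dom0], every [w] coming from some chart vector [u']. *)
right; split; first by apply/eqP; rewrite (@vec_Tinv_eq0 _ _ _ c (y, u))// u0.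
move=> w w0; have [u' u'E] := Tinv_surj w ac cy.
rewrite -u'E; apply: (dy _ _).1.
by rewrite -(@vec_Tinv_eq0 _ _ _ c (y, u') ac cy) u'E.
Qed.

Lemma phi_metric_continuous : {within dom, continuous F}.
Proof.
apply: TM_continuousP phi_dom_open _ => c z ac cz dz.
have [d0z|nd0z] := pselect (dom0 (Tinv c z)).
  exact: phi_metric_Ck 0 ac _ (conj cz d0z).
have [zE dzu] := dom_zero cz ac dz nd0z.
have [C Cx] := phi_metric_tube ac cz dzu.
have F0z y : ccod c y -> F (Tinv c (y, 0)) = 0.
  by move=> cy; rewrite /phi_metric (@vec_Tinv_eq0 _ _ _ c (y, 0))// eqxx.
(* The tube gives the estimate for [u != 0]; at [u = 0] both sides vanish, by the convention on
   [phi_metric]. *)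
have bound : \forall y \near z, `|F (Tinv c y)| <= C * `|y.2|.
  apply: filterS Cx => -[y u] /= [cy dy].
  by have [->|/dy[]//] := eqVneq u 0; rewrite F0z// !normr0 mulr0.
have z20 : z.2 = 0 by rewrite zE.
rewrite /prop_for /continuous_at /= {2}zE F0z//; apply/norm_cvg0P.
apply: (@squeeze_cvgr _ _ _ _ (cst 0) (fun y => C * `|y.2|)).
- by apply: filterS bound => y ->; rewrite normr_ge0.
- exact: cvg_cst.
- rewrite -[X in _ --> X](mulr0 C) -(@normr0 R 'rV[R]_n) -z20.
  apply: cvgMr; apply: cvg_norm; exact: continuous_snd.
Qed.

Hypothesis phi_gt0 : forall s, I s -> 0 < phi s.

Lemma phi_metric_gt0 v : dom0 v -> 0 < F v.
Proof.
move=> [v0 [Av Iv]]; rewrite /phi_metric (negbTE v0) mulr_gt0 ?phi_gt0//.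
exact: conic_pseudo_Finsler_gt0 F0_Finsler Av v0.
Qed.

Lemma phi_metric_conic_pseudo_Finsler :
  (@base R n M) @` dom = setT -> conic_pseudo_Finsler dom F.
Proof.
move=> dom_proj; split.
- exact: phi_dom_open.
- by [].
- move=> p v l [dv|[/= v0 dv]] l0; [left|right] => /=.
    exact: phi_dom0_conic.
  by rewrite v0 scaler0.
- move=> v [/phi_metric_gt0/ltW//|[v0 _]].
  by rewrite /phi_metric v0 eqxx.
- exact: phi_metric_continuous.
- move=> c ac k; apply: sub_Ck (phi_metric_Ck k ac) => z [cz [dz z0]].
  by split=> //; case: dz => // -[/z0].
- move=> v [dv|[v0 _]].
    split=> [Fv|v0]; first by have := phi_metric_gt0 dv; rewrite Fv ltxx.
    by have [/eqP] := dv.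
  by split=> // _; rewrite /phi_metric v0 eqxx.
- exact: phi_metric_homogeneous.
Qed.

End Domain.
End PhiMetricInCharts.

(** * The fundamental tensor *)

Section FundamentalTensor.
Context {R : realType} {n : nat} {M : manifold R n}.
Implicit Types (A : set (TM M)) (F : TM M -> R) (p : M) (v w : 'rV[R]_n).

Lemma near_eq_derive1 (f g : R -> R) (x : R) :
  (\forall y \near x, f y = g y) -> derive1 f x = derive1 g x.
Proof. by rewrite !derive1E; exact: near_eq_derive. Qed.

Lemma near_eq_derive1_derive1 (f g : R -> R) (x : R) :
  (\forall y \near x, f y = g y) -> derive1 (derive1 f) x = derive1 (derive1 g) x.
Proof.
move=> /near_join fg; apply: near_eq_derive1.
by apply: filterS fg => y; exact: near_eq_derive1.
Qed.

(** The two parameters enter only through their sum, [v + t w + s w = v + (t + s) w], so the inner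
    derivative at 0 is the derivative of the square at [t]. *)
Lemma fundamental_tensor_diag F p v w :
  fundamental_tensor F p v w w =
  2^-1 * derive1 (derive1 (fun r : R => F (TVec p (v + r *: w)) ^+ 2)) 0.
Proof.
rewrite /fundamental_tensor; set q := (fun r : R => _ ^+ 2).
rewrite (_ : (fun t => _) = derive1 q)//; apply/funext => t; rewrite /derive1.
rewrite (_ : (fun h => _) = (fun h => h^-1 *: (q (h + t) - q t)))//.
apply/funext => h.
by rewrite !addr0 scale0r addr0 -addrA -scalerDl (addrC t).
Qed.

Lemma pair_line (x v w : 'rV[R]_n) (r : R) : (x, v) + r *: (0, w) = (x, v + r *: w).
Proof. by congr pair; rewrite /= ?scaler0 ?addr0. Qed.

Lemma near_line_TM A p v w : open A -> A (TVec p v) ->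
  \forall r \near (0 : R), A (TVec p (v + r *: w)).
Proof.
move=> oA Av; pose c := chart_at p; pose x := cmap c p.
have cx : ccod c x by apply: cmap_cod; exact: chart_at_dom.
have oU := (open_TMP A).1 oA c (chart_at_atlas p).
have := @near_line R ('rV[R]_n * 'rV[R]_n)%type _ (x, v) (0, w) 0 oU.
rewrite scale0r addr0 /= Tinv_chart_at => /(_ (conj cx Av)).
by apply: filterS => r [_]; rewrite pair_line Tinv_chart_at.
Qed.

(** In [chart_at p] the line reads [(x, v) + r (0, w)], and [v != 0] puts [(x, v)] in the open set
    where [F] is smooth, so that [smooth_line] applies. *)
Lemma conic_pseudo_Finsler_line A F p v w :
  conic_pseudo_Finsler A F -> A (TVec p v) -> v != 0 ->
  let f := fun r => F (TVec p (v + r *: w)) in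
  exists2 f1 : R -> R, (\forall r \near (0 : R), is_derive r (1 : R) f (f1 r))
    & exists df1 : R, is_derive (0 : R) (1 : R) f1 df1.
Proof.
move=> cF Av v0 f; pose c := chart_at p; pose x := cmap c p.
have ac : atlas M c := chart_at_atlas p.
have cx : ccod c x by apply: cmap_cod; exact: chart_at_dom.
have := @smooth_line R ('rV[R]_n * 'rV[R]_n)%type _ (F \o Tinv c) (x, v) (0, w)
  (open_nonzero (cpF_open cF) ac) (cpF_smooth cF ac 2).
rewrite (_ : (fun r => _) = f); last first.
  by apply/funext => r /=; rewrite pair_line Tinv_chart_at.
apply; split => //=; rewrite Tinv_chart_at; split=> //=.
exact/eqP.
Qed.

Lemma derive1_derive1_sqr (f f1 : R -> R) (df1 : R) :
  (\forall r \near (0 : R), is_derive r (1 : R) f (f1 r)) ->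
  is_derive (0 : R) (1 : R) f1 df1 ->
  [/\ \forall r \near (0 : R), is_derive r (1 : R) (fun x => f x ^+ 2) (2 * (f r * f1 r)),
      is_derive (0 : R) (1 : R) (fun r => 2 * (f r * f1 r)) (2 * (f1 0 ^+ 2 + f 0 * df1))
    & derive1 (derive1 (fun r => f r ^+ 2)) 0 = 2 * (f1 0 ^+ 2 + f 0 * df1)].
Proof.
move=> ff1 df.
have d1 : \forall r \near (0 : R), is_derive r (1 : R) (fun x => f x ^+ 2) (2 * (f r * f1 r)).
  apply: filterS ff1 => r dfr; rewrite (_ : (fun x => _) = (fun x => f x * f x)).
    by apply: is_derive_eq (is_derive_mul dfr dfr) _; ring.
  by apply/funext => x; rewrite expr2.
have d2 : is_derive (0 : R) (1 : R) (fun r => 2 * (f r * f1 r)) (2 * (f1 0 ^+ 2 + f 0 * df1)).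
  apply: is_derive_eq (is_derive_mul (is_derive_const 2 0)
    (is_derive_mul (nbhs_singleton ff1) df)) _.
  by ring.
by split=> //; apply: is_derive_derive1; exact: near_is_derive_derive1 d1 d2.
Qed.

(** * Fundamental tensor and angular metric in terms of the 2-jet along a line of the fibre *)

Section Line.
Variables (A : set (TM M)) (F : TM M -> R) (p : M) (v w : 'rV[R]_n).
Variables (f1 : R -> R) (df1 : R).
Hypotheses (cF : conic_pseudo_Finsler A F) (Av : A (TVec p v)) (v0 : v != 0).
Let f (r : R) := F (TVec p (v + r *: w)).
Hypothesis ff1 : \forall r \near (0 : R), is_derive r (1 : R) f (f1 r).
Hypothesis f1f2 : is_derive (0 : R) (1 : R) f1 df1.

Let f0 : f 0 = F (TVec p v).
Proof. by rewrite /f scale0r addr0. Qed.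

Let Fv_neq0 : F (TVec p v) != 0.
Proof. by rewrite gt_eqF// (conic_pseudo_Finsler_gt0 cF Av). Qed.

Lemma fundamental_tensor_line :
  fundamental_tensor F p v w w = f1 0 ^+ 2 + F (TVec p v) * df1.
Proof.
have [_ _ ffE] := derive1_derive1_sqr ff1 f1f2.
by rewrite fundamental_tensor_diag -/f ffE f0 mulKf ?pnatr_eq0.
Qed.

(** As [v + t v + s w = (1 + t) (v + s / (1 + t) w)], the square of [F] is
    [(1 + t)^2 f(s / (1 + t))^2] by homogeneity. Its derivative at [s = 0] is
    [2 (1 + t) f(0) f'(0)], affine in [t]. *)
Lemma fundamental_tensor_radial :
  fundamental_tensor F p v v w = F (TVec p v) * f1 0.
Proof.
have [dq dq1 _] := derive1_derive1_sqr ff1 f1f2.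
rewrite /fundamental_tensor (@near_eq_derive1 _
  (fun t => 2 * (f 0 * f1 0) + t * (2 * (f 0 * f1 0)))).
  by rewrite (is_derive_derive1 (is_derive_affine _ _ _)) f0 mulKf ?pnatr_eq0.
(* Homogeneity requires a positive factor and, below, a vector of [A]; both are secured near 0. *)
have t0 : \forall t \near (0 : R), 0 < 1 + t * (1 : R).
  have := is_derive_continuous (is_derive_affine 1 1 0) => c1.
  have : nbhs (1 + 0 * 1 : R) [set y | 0 < y].
    by apply: open_nbhs_nbhs; split; [exact: open_gt|rewrite /= mul0r addr0 ltr01].
  exact: c1.
apply: filterS t0 => t; rewrite mulr1 => t0.
have tn0 : 1 + t != 0 by rewrite gt_eqF.
pose m (s : R) := 0 + s * (1 + t)^-1.
have dm := is_derive_affine 0 (1 + t)^-1 0; rewrite -/m in dm.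
have m0 : m 0 = 0 by rewrite /m mul0r addr0.
have Am : \forall s \near (0 : R), A (TVec p (v + m s *: w)).
  have : nbhs (m 0) [set r | A (TVec p (v + r *: w))].
    by rewrite m0; exact: near_line_TM (cpF_open cF) Av.
  exact: (is_derive_continuous dm).
rewrite (@near_eq_derive1 _ (fun s => (1 + t) ^+ 2 * f (m s) ^+ 2)); last first.
  apply: filterS Am => s As; rewrite -exprMn /f -(cpF_homogeneous cF)//.
  congr (F (TVec p _) ^+ 2).
  by rewrite scalerDr scalerDl scale1r scalerA /m add0r mulrC mulfVK.
have dqm : is_derive (m 0) (1 : R) (fun r => f r ^+ 2) (2 * (f 0 * f1 0)).
  by rewrite m0; exact: (nbhs_singleton dq).
rewrite (is_derive_derive1 (is_derive_mul (is_derive_const ((1 + t) ^+ 2) 0)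
  (is_derive_comp dm dqm))) /=.
by field.
Qed.

(** The term [f'(0)^2] of [g_v(w,w)] is exactly the square subtracted in the angular metric. *)
Lemma angular_metric_line : angular_metric F p v w = F (TVec p v) * df1.
Proof.
rewrite /angular_metric fundamental_tensor_line fundamental_tensor_radial.
by field.
Qed.

(** Here [a] is [g_v(v,w) / F(v)^2]. Since [v + r (w - a v) = (1 - a r) (v + r / (1 - a r) w)],
    [derive_homogeneous_line] gives the second derivative of the square; for this [a] the terms in
    [f'(0)] cancel and [f(0) f''(0)] remains. Positivity of [g_v] thereby reaches the angular
    metric. *)
Lemma fundamental_tensor_angular :
  let a := f1 0 / F (TVec p v) in
  fundamental_tensor F p v (w - a *: v) (w - a *: v) = angular_metric F p v w.
Proof.
move=> a; have [dq dq1 _] := derive1_derive1_sqr ff1 f1f2.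
rewrite fundamental_tensor_diag angular_metric_line.
rewrite (@near_eq_derive1_derive1 _
  (fun r => (1 - a * r) ^+ 2 * f (r / (1 - a * r)) ^+ 2)); last first.
  pose l (r : R) := 1 + r * - a.
  have dl := is_derive_affine 1 (- a) 0; rewrite -/l in dl.
  have l0 : l 0 = 1 by rewrite /l mul0r addr0.
  have l0N0 : l 0 != 0 by rewrite l0 oner_neq0.
  have lgt0 : \forall r \near (0 : R), 0 < l r.
    have : nbhs (l 0) [set y | 0 < y].
      by apply: open_nbhs_nbhs; split; [exact: open_gt|rewrite /= l0 ltr01].
    exact: (is_derive_continuous dl).
  pose m (r : R) := r * (l r)^-1.
  have dm := is_derive_mul (is_derive_id (0 : R) (1 : R)) (is_derive_inv l0N0 dl).
  have Am : \forall r \near (0 : R), A (TVec p (v + m r *: w)).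
    have : nbhs (m 0) [set r | A (TVec p (v + r *: w))].
      by rewrite /m mul0r; exact: near_line_TM (cpF_open cF) Av.
    exact: (is_derive_continuous dm).
  apply: filterS2 lgt0 Am => r lr Ar.
  have lE : 1 - a * r = l r by rewrite /l mulrN mulrC.
  rewrite lE -exprMn /f -(cpF_homogeneous cF)//.
  congr (F (TVec p _) ^+ 2); rewrite [RHS]scalerDr scalerA (mulrC (l r)) mulfVK ?gt_eqF//.
  rewrite /l scalerDl scale1r scalerBr !scalerA mulrN scaleNr -addrA.
  by rewrite [- _ + _]addrC.
rewrite (derive_homogeneous_line a dq dq1) f0 /a.
by field.
Qed.

End Line.
End FundamentalTensor.

(** * The formula for the fundamental tensor of [phi_metric], and its positivity *)

Section PhiFundamentalTensor.
Context {R : realType}.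
Variables (I : set R) (phi : R -> R).
Hypotheses (I_open : open I) (phi_smooth : smooth1 I phi).
Hypothesis phi_gt0 : forall s, I s -> 0 < phi s.

Let dphi s : I s -> is_derive s (1 : R) phi (derive1 phi s).
Proof.
move=> Is; apply: derive1_is_derive.
exact: (@phi_smooth 0%N).
Qed.

Let ddphi s : I s -> is_derive s (1 : R) (derive1 phi) (derive1 (derive1 phi) s).
Proof.
move=> Is; apply: derive1_is_derive.
exact: (@phi_smooth 1%N).
Qed.

Lemma is_derive_psi s : I s ->
  is_derive s (1 : R) (psi phi) (2 * (phi s * derive1 phi s)).
Proof.
move=> Is; rewrite (_ : psi phi = (fun x => phi x * phi x)).
  by apply: is_derive_eq (is_derive_mul (dphi Is) (dphi Is)) _; ring.
by apply/funext => x; rewrite /psi expr2.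
Qed.

Lemma is_derive_derive1_psi s : I s ->
  is_derive s (1 : R) (derive1 (psi phi))
    (2 * (derive1 phi s ^+ 2 + phi s * derive1 (derive1 phi) s)).
Proof.
move=> Is; apply: (@near_is_derive_derive1 _ _ (fun s => 2 * (phi s * derive1 phi s))).
  by apply: filterS (open_nbhs_nbhs (conj I_open Is)) => r; exact: is_derive_psi.
apply: is_derive_eq (is_derive_mul (is_derive_const 2 s)
  (is_derive_mul (dphi Is) (ddphi Is))) _.
by ring.
Qed.

Lemma varphi1E s : I s ->
  varphi1 phi s = 2 * phi s * (phi s - s * derive1 phi s).
Proof.
by move=> Is; rewrite /varphi1 (is_derive_derive1 (is_derive_psi Is)) /psi; ring.
Qed.

Lemma varphi2E s : I s ->
  varphi2 phi s = 4 * derive1 (derive1 phi) s * phi s ^+ 3.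
Proof.
move=> Is; rewrite /varphi2 (is_derive_derive1 (is_derive_psi Is)).
by rewrite (is_derive_derive1 (is_derive_derive1_psi Is)) /psi; ring.
Qed.

Lemma varphi1_gt0 s : I s ->
  (0 < varphi1 phi s) = (0 < phi s - s * derive1 phi s).
Proof. by move=> Is; rewrite varphi1E// pmulr_rgt0// mulr_gt0// phi_gt0. Qed.

Lemma varphi2_ge0 s : I s -> (0 <= varphi2 phi s) = (0 <= derive1 (derive1 phi) s).
Proof.
move=> Is; rewrite varphi2E// pmulr_lge0 ?pmulr_rge0//.
by rewrite exprn_gt0// phi_gt0.
Qed.

Context {n : nat} {M : manifold R n}.
Variables (A0 : set (TM M)) (F0 beta : TM M -> R).
Hypotheses (F0_Finsler : conic_pseudo_Finsler A0 F0) (beta_form : one_form beta).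

(** Both sides are rational in the 2-jet of [F0] along the line, the values of [beta] at [v] and
    [w], and the 2-jet of [psi] at [s]; [derive_phi_line] computes the left-hand side. *)
Lemma phi_fundamental_tensor p (v w : 'rV[R]_n) :
  phi_dom0 A0 F0 beta I (TVec p v) ->
  let s := beta (TVec p v) / F0 (TVec p v) in
  2 * fundamental_tensor (phi_metric F0 beta phi) p v w w =
    varphi1 phi s * angular_metric F0 p v w
    + varphi2 phi s / (2 * psi phi s)
      * (beta (TVec p v) / F0 (TVec p v) ^+ 2 * fundamental_tensor F0 p v v w
         - beta (TVec p w)) ^+ 2
    + (2 * psi phi s)^-1
      * (varphi1 phi s * (fundamental_tensor F0 p v v w / F0 (TVec p v))
         + derive1 (psi phi) s * beta (TVec p w)) ^+ 2.
Proof.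
move=> [v0 [Av Is]] s; have {}v0 : v != 0 := v0.
have [f1 ff1 [df1 f1f2]] := conic_pseudo_Finsler_line w F0_Finsler Av v0.
have Fv0 : F0 (TVec p v) != 0.
  by rewrite gt_eqF// (conic_pseudo_Finsler_gt0 F0_Finsler Av).
have psi0 : psi phi s != 0 by rewrite /psi expf_neq0// gt_eqF// phi_gt0.
rewrite (fundamental_tensor_radial F0_Finsler Av ff1 f1f2).
rewrite (angular_metric_line F0_Finsler Av v0 ff1 f1f2).
rewrite fundamental_tensor_diag mulVKf ?pnatr_eq0//.
pose f (r : R) := F0 (TVec p (v + r *: w)).
rewrite (@near_eq_derive1_derive1 _ _ (fun r => f r ^+ 2 *
    psi phi ((beta (TVec p v) + r * beta (TVec p w)) / f r))); last first.
  apply: filterS (near_line_TM w (cpF_open F0_Finsler) Av) => r Ar.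
  rewrite /psi -exprMn -/(f r) /phi_metric /=.
  have -> : beta (TVec p v) + r * beta (TVec p w) = beta (TVec p (v + r *: w)).
    by rewrite addrC -beta_form.1 addrC.
  (* If [v + r w] is zero, [phi_metric] is 0 by convention, and the other side is 0 because [F0]
     vanishes there. *)
  case: eqP => // vr0.
  rewrite /f; have -> : F0 (TVec p (v + r *: w)) = 0 by exact/(cpF_eq0 F0_Finsler Ar).
  by rewrite mul0r.
have dpsi1 t : I t -> is_derive t (1 : R) (derive1 (psi phi)) (derive1 (derive1 (psi phi)) t).
  by move=> It; have d := is_derive_derive1_psi It; rewrite (is_derive_derive1 d).
have dpsi t : I t -> is_derive t (1 : R) (psi phi) (derive1 (psi phi) t).
  by move=> It; have d := is_derive_psi It; rewrite (is_derive_derive1 d).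
rewrite (@derive_phi_line _ _ _ _ _ _ _ _ _ _ I_open dpsi dpsi1 ff1 f1f2) /= ?scale0r ?addr0//.
rewrite -/s /varphi1 /varphi2; move: psi0.
(* Eliminating the value of [beta] at [v] in favour of [s] leaves [psi(s)] and [F0(v)] as the only
   denominators. *)
have sE : beta (TVec p v) = s * F0 (TVec p v) by rewrite /s mulfVK.
rewrite sE.
move: (psi phi s) (derive1 (psi phi) s) (derive1 (derive1 (psi phi)) s) => a b c a0.
by field; rewrite a0 Fv0.
Qed.

(** The three terms of the formula are nonnegative; the first is positive when [w != a v], the third
    when [w = a v]. *)
Lemma phi_fundamental_tensor_gt0 p (v w : 'rV[R]_n) :
  (forall w, w != 0 -> 0 < fundamental_tensor F0 p v w w) ->
  (forall s, I s -> 0 < varphi1 phi s) -> (forall s, I s -> 0 <= varphi2 phi s) ->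
  phi_dom0 A0 F0 beta I (TVec p v) -> w != 0 ->
  0 < fundamental_tensor (phi_metric F0 beta phi) p v w w.
Proof.
move=> g0_gt0 phi1 phi2 dv w0; have [/= v0 [Av Is]] := dv.
rewrite -(@pmulr_rgt0 _ 2)// phi_fundamental_tensor//.
set s := beta (TVec p v) / F0 (TVec p v) in Is *.
have [f1 ff1 [df1 f1f2]] := conic_pseudo_Finsler_line w F0_Finsler Av v0.
have Fv0 : 0 < F0 (TVec p v) by rewrite (conic_pseudo_Finsler_gt0 F0_Finsler Av).
have psi0 : 0 < psi phi s by rewrite /psi exprn_gt0// phi_gt0.
have := fundamental_tensor_angular F0_Finsler Av v0 ff1 f1f2.
rewrite (fundamental_tensor_radial F0_Finsler Av ff1 f1f2) /=.
set a := f1 0 / _ => hE; rewrite -/s; set Y := (_ - _) ^+ 2.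
have f1E : f1 0 = a * F0 (TVec p v) by rewrite /a mulfVK ?gt_eqF.
move: @a f1E hE => a f1E hE.
have Y0 : 0 <= varphi2 phi s / (2 * psi phi s) * Y.
  by rewrite mulr_ge0 ?sqr_ge0// mulr_ge0 ?phi2// invr_ge0 mulr_ge0// ltW.
have [wE|wN] := eqVneq (w - a *: v) 0; last first.
  apply: ltr_wpDr; first by rewrite mulr_ge0 ?sqr_ge0// invr_ge0 mulr_ge0// ltW.
  apply: ltr_wpDr Y0 _; apply: mulr_gt0; first exact: phi1.
  by rewrite -hE g0_gt0.
(* By [hE] this is the fundamental tensor in the direction 0, half the second derivative of a
   constant. *)
have h0 : angular_metric F0 p v w = 0.
  rewrite -hE wE fundamental_tensor_diag.
  under eq_fun do rewrite scaler0 addr0.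
  rewrite (_ : derive1 _ = cst 0) ?derive1_cst ?mulr0//.
  by apply/funext => r; exact: derive1_cst.
have wa : w = a *: v by apply/eqP; rewrite -subr_eq0 wE.
have a0 : a != 0 by apply: contraNneq w0 => a0; rewrite wa a0 scale0r.
rewrite h0 mulr0 add0r; apply: ltr_wpDl => //.
apply: mulr_gt0; first by rewrite invr_gt0 mulr_gt0.
rewrite exprn_even_gt0//= wa one_formZ// f1E /varphi1.
have -> : beta (TVec p v) = s * F0 (TVec p v) by rewrite mulfVK ?gt_eqF.
(* By definition [varphi1(s) + s psi'(s) = 2 psi(s)], so the square is nonzero along with [a],
   [psi(s)] and [F0(v)]. *)
rewrite (_ : _ + _ = 2 * (psi phi s * (a * F0 (TVec p v)))).
  rewrite mulf_neq0 ?pnatr_eq0// mulf_neq0 ?(gt_eqF psi0)//.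
  by rewrite mulf_neq0 ?(gt_eqF Fv0).
by field; rewrite gt_eqF.
Qed.

End PhiFundamentalTensor.

Theorem proposition4p10 (R : realType) (n : nat) (M : manifold R n)
    (I : set R) (phi : R -> R)
    (A0 : set (TM M)) (F0 : TM M -> R) (beta : TM M -> R)
    (I_open : open I)
    (phi_smooth : smooth1 I phi)
    (phi_gt0 : forall s, I s -> 0 < phi s)
    (F0_Finsler : conic_Finsler A0 F0)
    (beta_form : one_form beta)
    (A_proj : (@base R n M) @` phi_dom A0 F0 beta I = setT) :
  let A := phi_dom A0 F0 beta I in
  let F := phi_metric F0 beta phi in
  let g0 := fundamental_tensor F0 in
  let g := fundamental_tensor F in
  let h0 := angular_metric F0 in
  [/\ conic_pseudo_Finsler A F,
      forall s, I s ->
        [/\ varphi1 phi s = 2 * phi s * (phi s - s * derive1 phi s),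
            varphi2 phi s = 4 * derive1 (derive1 phi) s * phi s ^+ 3,
            0 < varphi1 phi s <-> 0 < phi s - s * derive1 phi s
          & 0 <= varphi2 phi s <-> 0 <= derive1 (derive1 phi) s],
      forall (p : M) (v w : 'rV[R]_n), A (TVec p v) -> v != 0 ->
        let s := beta (TVec p v) / F0 (TVec p v) in
        2 * g p v w w =
          varphi1 phi s * h0 p v w
          + varphi2 phi s / (2 * psi phi s)
            * (beta (TVec p v) / F0 (TVec p v) ^+ 2 * g0 p v v w
               - beta (TVec p w)) ^+ 2
          + (2 * psi phi s)^-1
            * (varphi1 phi s * (g0 p v v w / F0 (TVec p v))
               + derive1 (psi phi) s * beta (TVec p w)) ^+ 2
    & (forall s, I s -> 0 < varphi1 phi s) ->
      (forall s, I s -> 0 <= varphi2 phi s) ->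
      conic_Finsler A F].
Proof.
move=> A F g0 g h0; have [cF0 g0_gt0] := F0_Finsler.
have cF := phi_metric_conic_pseudo_Finsler I_open phi_smooth cF0 beta_form phi_gt0 A_proj.
(* The zero-vector clause of [phi_dom] is excluded by [v != 0], so the results on [phi_dom0]
   apply. *)
have dom0 p (v : 'rV[R]_n) : A (TVec p v) -> v != 0 -> phi_dom0 A0 F0 beta I (TVec p v).
  by move=> [//|[/= ->]] _; rewrite eqxx.
split=> //.
- move=> s Is; split; [exact: (varphi1E phi_smooth)|exact: (varphi2E I_open phi_smooth)| |].
    by rewrite (varphi1_gt0 phi_smooth phi_gt0 Is).
  by rewrite (varphi2_ge0 I_open phi_smooth phi_gt0 Is).
- move=> p v w Av v0 s; exact: phi_fundamental_tensor (dom0 _ _ Av v0).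
- move=> phi1 phi2; split=> // p v w Av v0 w0.
  have dv := dom0 _ _ Av v0.
  apply: (phi_fundamental_tensor_gt0 I_open phi_smooth phi_gt0 cF0 beta_form
    _ phi1 phi2 dv w0) => u u0.
  by apply: g0_gt0 => //; case: dv => _ [].
Qed.
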